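(* Let $n\ge 1$ and let $A$ be a totally positive $(n+1)\times(n+1)$ real matrix. Let $(t_{i,j})_{0\le i,j\le n}$ be the essential positive weighting associated with $A$, i.e. the family of positive reals such that the essential planar network of order $n$ with weighting $(t_{i,j})$ has weight matrix $A$. Decompose this network into its $L$-type, $D$-type and $U$-type subnetworks of order $n$, with weight matrices $L_n$, $D_n$, $U_n$ respectively. Then $A=L_nD_nU_n$, and this is the LDU decomposition of $A$: $L_n$ is unit lower triangular, $D_n$ is diagonal, $U_n$ is unit upper triangular, and whenever $A=LDU$ with $L$ unit lower triangular, $D$ diagonal and $U$ unit upper triangular, one has $L=L_n$, $D=D_n$, $U=U_n$.
   Context: A real matrix is totally positive if all its minors are positive. Rows and columns of $(n+1)\times(n+1)$ matrices are indexed by $0,1,\dots,n$. $\mathbb{N}_0$ is the set of nonnegative integers. The weight $\omega(p)$ of a path $p$ is the product of the weights of its edges (steps). Let $(t_{i,j})_{0\le i,j\le n}$ be positive reals and $m\in\mathbb{N}_0$. $L$-type: an $\mathcal{L}^m_n$-path is a sequence of $n+1$ points $(x_i,y_i)\in\mathbb{N}_0\times\mathbb{N}_0$, $i=0,\dots,n$, with $x_i=m+i$, $y_i\in\{0,\dots,n\}$, $y_{i+1}\in\{y_i,y_i-1\}$ for $i<n$, and such that $y_{i+1}=y_i-1$ implies $y_i\ge n-i$. The fall edge from $(m+i,j)$ to $(m+i+1,j-1)$ (with $j\neq 0$) has weight $t_{j,i+j-n}$, and each horizontal edge from $(m+i,j)$ to $(m+i+1,j)$ has weight $1$. $L_n[i,j]$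 is the sum of $\omega(p)$ over all $\mathcal{L}^0_n$-paths $p$ with $y_0=i$, $y_n=j$. $D$-type: a $\mathcal{D}^m_n$-path is a single horizontal step from $(m,j)$ to $(m+1,j)$, $j\in\{0,\dots,n\}$, with weight $t_{j,j}$. $D_n[i,j]$ is the sum of $\omega(p)$ over all $\mathcal{D}^0_n$-paths $p$ that start at height $i$ and end at height $j$. $U$-type: a $\mathcal{U}^m_n$-path is a sequence of $n+1$ points $(x_i,y_i)\in\mathbb{N}_0\times\mathbb{N}_0$, $i=0,\dots,n$, with $x_i=m+i$, $y_i\in\{0,\dots,n\}$, $y_{i+1}\in\{y_i,y_i+1\}$ for $i<n$, and such that $y_{i+1}=y_i+1$ implies $y_i\ge i$. The rise edge from $(m+i,j)$ to $(m+i+1,j+1)$ (with $j\ne n$) has weight $t_{j-i,j+1}$, and each horizontal edge has weight $1$. $U_n[i,j]$ is the sum of $\omega(p)$ over all $\mathcal{U}^0_n$-paths $p$ with $y_0=i$, $y_n=j$. The essential planar network of order $n$ with weighting $(t_{i,j})$ is the concatenation, from left to right, of the $L$-type, $D$-type and $U$-type networks: its paths from source $i$ to sink $j$ are obtained by following an $\mathcal{L}^0_n$-path starting at height $i$, then a $\mathcal{D}^n_n$-path, then a $\mathcal{U}^{n+1}_n$-path ending at height $j$ (each starting where the previous one ends). Its weight matrix has $(i,j)$ entry equal to the sum of the weights of all paths from source $i$ to sink $j$. By a known theorem of Fomin and Zelevinsky, assigning to a positive weighting $(t_{i,j})_{0\le i,j\le n}$ the weight matrix of the essential planar network of order $n$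 is a bijection onto the totally positive $(n+1)\times(n+1)$ matrices; the weighting associated with $A$ is the preimage of $A$. *)

(* Defs.v *)
(* Mathematical Components; [realType] models the reals. *)
From mathcomp Require Import all_boot all_order all_algebra.
From mathcomp Require Import reals.

Set Implicit Arguments.
Unset Strict Implicit.
Unset Printing Implicit Defensive.

Import Order.TTheory GRing.Theory Num.Theory.

Local Open Scope nat_scope.

(* A lattice point (x, y). *)
Definition point := (nat * nat)%type.

Definition pt (p : seq point) (i : nat) : point := nth (0, 0) p i.

(* A fall is written [y = y'.+1] rather than [y' = y.-1], because truncated
   subtraction would make 0 -> 0 a fall. *)
Definition is_Lpath (n m : nat) (p : seq point) : bool :=
  [&& size p == n.+1,
      [forall i : 'I_n.+1, ((pt p i).1 == m + i) && ((pt p i).2 <= n)] &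
      [forall i : 'I_n,
         let y := (pt p i).2 in let y' := (pt p i.+1).2 in
         ((y' == y) || (y == y'.+1)) && ((y == y'.+1) ==> (n - i <= y))]].

Definition is_Dpath (n m : nat) (p : seq point) : bool :=
  [exists j : 'I_n.+1, p == [:: (m, j : nat); (m.+1, j : nat)]].

Definition is_Upath (n m : nat) (p : seq point) : bool :=
  [&& size p == n.+1,
      [forall i : 'I_n.+1, ((pt p i).1 == m + i) && ((pt p i).2 <= n)] &
      [forall i : 'I_n,
         let y := (pt p i).2 in let y' := (pt p i.+1).2 in
         ((y' == y) || (y' == y.+1)) && ((y' == y.+1) ==> (i <= y))]].

(* Points 0..n form an L-path, points n, n+1 a D-path, and points n+1..2n+1 a
   U-path; consecutive pieces share their common endpoint. *)
Definition is_Npath (n : nat) (p : seq point) : bool :=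
  [&& size p == (n + 1 + n).+1,
      is_Lpath n 0 (take n.+1 p),
      is_Dpath n n (take 2 (drop n p)) &
      is_Upath n n.+1 (drop n.+1 p)].

(* The points (m, y_0), (m+1, y_1), ...: as the abscissas of all the paths above
   are consecutive integers, a path is determined by m and its heights. *)
Definition points_from (n m : nat) (y : seq 'I_n.+1) : seq point :=
  zip (iota m (size y)) (map val y).

Local Open Scope ring_scope.

Section Weights.
Variables (R : realType) (n : nat) (t : 'M[R]_n.+1).

(* Weight of the edge from u to v in each type of network. On actual edges the
   indices passed to [inord] are at most n, and the subtractions of naturals are
   exact. *)
Definition Lweight (m : nat) (u v : point) : R :=
  if v.2 == u.2 then 1
  else t (inord u.2) (inord ((u.1 - m) + u.2 - n)%N).

Definition Dweight (u v : point) : R := t (inord u.2) (inord u.2).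

Definition Uweight (m : nat) (u v : point) : R :=
  if v.2 == u.2 then 1
  else t (inord (u.2 - (u.1 - m))%N) (inord u.2.+1).

Definition Nweight (u v : point) : R :=
  if (u.1 < n)%N then Lweight 0 u v
  else if u.1 == n then Dweight u v
  else Uweight n.+1 u v.

Definition path_weight (w : point -> point -> R) (p : seq point) : R :=
  \prod_(i < (size p).-1) w (pt p i) (pt p i.+1).

(* Sum over the paths satisfying P which have k edges and start at abscissa m,
   from height i to height j. *)
Definition weight_mx (P : pred (seq point)) (w : point -> point -> R)
    (m k : nat) : 'M[R]_n.+1 :=
  \matrix_(i, j)
    \sum_(y : k.+1.-tuple 'I_n.+1 |
          [&& P (points_from m y), tnth y ord0 == i & tnth y ord_max == j])
      path_weight w (points_from m y).

Definition L_mx : 'M[R]_n.+1 := weight_mx (is_Lpath n 0) (Lweight 0) 0 n.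
Definition D_mx : 'M[R]_n.+1 := weight_mx (is_Dpath n 0) Dweight 0 1.
Definition U_mx : 'M[R]_n.+1 := weight_mx (is_Upath n 0) (Uweight 0) 0 n.

Definition network_mx : 'M[R]_n.+1 :=
  weight_mx (is_Npath n) Nweight 0 (n + 1 + n).

End Weights.

(* The case k = 0 is harmless: the empty minor is 1. *)
Definition totally_positive (R : realType) (n : nat) (A : 'M[R]_n) : Prop :=
  forall (k : nat) (f g : 'I_k -> 'I_n),
    {homo f : i j / (i < j)%N} -> {homo g : i j / (i < j)%N} ->
    0 < \det (mxsub f g A).

(* [is_trig_mx] is lower triangularity. *)
Definition unit_lower (R : realType) (n : nat) (M : 'M[R]_n) : Prop :=
  is_trig_mx M /\ forall i, M i i = 1.

Definition unit_upper (R : realType) (n : nat) (M : 'M[R]_n) : Prop :=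
  is_trig_mx M^T /\ forall i, M i i = 1.

Definition is_LDU (R : realType) (n : nat) (A L D U : 'M[R]_n) : Prop :=
  [/\ unit_lower L, is_diag_mx D, unit_upper U & A = L *m D *m U].

(* Main.v *)
Require Import Defs.
From mathcomp Require Import all_boot all_order all_algebra.
From mathcomp Require Import reals.
From mathcomp Require Import zify.

Set Implicit Arguments.
Unset Strict Implicit.
Unset Printing Implicit Defensive.

Import Order.TTheory GRing.Theory Num.Theory.

Local Open Scope ring_scope.

(** The whole theorem rests on the transfer-matrix principle.  A path of each
network is a list of heights subject only to conditions on consecutive heights,
and its weight is a product over consecutive heights.  Recording the admissible
steps at one abscissa, with their weights, in a matrix (with 0 for a step that
is not admissible), the sum over all paths from [i] to [j] is the [(i, j)] entry
of the product of these step matrices ([weight_mx_prod_steps]).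

Two consequences follow.  The step matrices of the full network are those of the
[L]-type network, then the single one of the [D]-type network, then those of the
[U]-type network, so that its weight matrix is the product of the three weight
matrices ([network_mxE]).  Moreover each [L]-step either keeps the height, with
weight 1, or decreases it; hence each [L]-step matrix is unit lower triangular
and so is their product.  Symmetrically [U_mx t] is unit upper triangular, and
[D_mx t] is the diagonal matrix of the [t i i].

Uniqueness ([LDU_unique]) is the usual argument: if [L D U = L' D' U'], then
[D (U U'^-1) = (L^-1 L') D'] is both upper and lower triangular, its diagonal
gives [D = D'], and since the entries of [D] are nonzero, [U U'^-1] and
[L^-1 L'] are both the identity.  Here the diagonal entries [t i i] of [D_mx t]
are nonzero because the weighting is positive. *)

(** * Sums over paths as products of matrices *)

Lemma sum_tuple_cons (R : nmodType) (T : finType) (k : nat)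
    (F : k.+1.-tuple T -> R) :
  \sum_y F y = \sum_a \sum_(y : k.-tuple T) F [tuple of a :: y].
Proof.
rewrite pair_big /=.
rewrite (reindex (fun p : T * k.-tuple T => [tuple of p.1 :: p.2])) //=.
exists (fun y => (thead y, behead_tuple y)) => [[a y] _|y _] /=.
  by congr (_, _); apply: val_inj.
by rewrite [RHS]tuple_eta; apply: val_inj.
Qed.

(** Expanding every matrix product in [W 0 * W 1 * ... * W (k - 1)] gives one term
for each sequence of [k + 1] indices; the indices play the role of the heights
of a path. *)
Lemma prod_mx_entry_sum_paths (R : nzRingType) (n k : nat)
    (W : nat -> 'M[R]_n.+1) (i j : 'I_n.+1) :
  (\prod_(l < k) W l) i j =
  \sum_(y : k.+1.-tuple 'I_n.+1 |
        (nth ord0 y 0 == i) && (nth ord0 y k == j))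
    \prod_(l < k) W l (nth ord0 y l) (nth ord0 y l.+1).
Proof.
(* Induction on the length removes the first step, so [W] has to be shifted. *)
elim: k W i => [|k IHk] W i; rewrite [RHS]big_mkcond sum_tuple_cons /=.
  rewrite big_ord0 mxE (bigD1 i) //=.
  rewrite [X in _ = _ + X]big1 ?addr0 => [|a /negPf ne_ai].
    rewrite (big_pred1 [tuple]) => [|y]; last by rewrite (tuple0 y) /= eqxx.
    by rewrite /= eqxx big_ord0 /=; case: (i == j).
  by rewrite big1 // => y _; rewrite ne_ai.
rewrite big_ord_recl -mulmxE mxE /=.
rewrite [RHS](bigD1 i) //= [X in _ = _ + X]big1 => [|a /negPf ne_ai]; last first.
  by rewrite big1 // => y _; rewrite ne_ai.
rewrite addr0 eqxx /=.
under eq_bigr => c _ do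
  rewrite (IHk (fun l => W l.+1)) big_distrr /= big_mkcond.
rewrite exchange_big /=; apply: eq_bigr => y _.
rewrite (bigD1 (nth ord0 y 0)) //= eqxx [X in _ + X]big1 ?addr0 => [|c]; last first.
  by rewrite eq_sym => /negPf->.
by rewrite big_ord_recl.
Qed.

Lemma forall_big_and (I : finType) (B : pred I) :
  [forall i, B i] = \big[andb/true]_i B i.
Proof. by rewrite big_andE. Qed.

(** * Paths as step conditions on consecutive heights *)

Arguments pt : simpl never.

Section PointsFrom.
Variable n : nat.
Implicit Types (m i : nat) (y : seq 'I_n.+1).

Lemma size_points_from m y : size (points_from m y) = size y.
Proof. by rewrite size_zip size_iota size_map minnn. Qed.

Lemma pt_points_from m y i : (i < size y)%N ->
  pt (points_from m y) i = ((m + i)%N, nth ord0 y i : nat).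
Proof.
move=> lt_iy; rewrite /pt nth_zip ?size_map ?size_iota //.
by rewrite nth_iota // (nth_map ord0).
Qed.

Lemma points_from_in_strip m y : size y = n.+1 ->
  [forall i : 'I_n.+1, ((pt (points_from m y) i).1 == (m + i)%N) &&
                       ((pt (points_from m y) i).2 <= n)%N].
Proof.
move=> sz_y; apply/forallP => i; rewrite pt_points_from ?sz_y //= eqxx /=.
by rewrite -ltnS.
Qed.

Lemma take_points_from k m y :
  take k (points_from m y) = points_from m (take k y).
Proof.
rewrite /points_from.
by elim: y k m => [|a y IHy] [|k] m //=; rewrite IHy.
Qed.

Lemma drop_points_from k m y :
  drop k (points_from m y) = points_from (m + k) (drop k y).
Proof.
rewrite /points_from.
elim: y k m => [|a y IHy] [|k] m //=; rewrite ?addn0 //.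
by rewrite IHy addSnnS.
Qed.

Definition Lstep (i a b : nat) : bool :=
  ((b == a) || (a == b.+1)) && ((a == b.+1) ==> (n - i <= a)%N).

Definition Ustep (i a b : nat) : bool :=
  ((b == a) || (b == a.+1)) && ((b == a.+1) ==> (i <= a)%N).

Lemma is_Lpath_points_from m y : size y = n.+1 ->
  is_Lpath n m (points_from m y) =
  [forall i : 'I_n, Lstep i (nth ord0 y i) (nth ord0 y i.+1)].
Proof.
move=> sz_y; rewrite /is_Lpath size_points_from sz_y eqxx points_from_in_strip //=.
apply: eq_forallb => i.
by rewrite !pt_points_from ?sz_y ?ltnS ?ltn_ord // ltnW.
Qed.

Lemma is_Upath_points_from m y : size y = n.+1 ->
  is_Upath n m (points_from m y) =
  [forall i : 'I_n, Ustep i (nth ord0 y i) (nth ord0 y i.+1)].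
Proof.
move=> sz_y; rewrite /is_Upath size_points_from sz_y eqxx points_from_in_strip //=.
apply: eq_forallb => i.
by rewrite !pt_points_from ?sz_y ?ltnS ?ltn_ord // ltnW.
Qed.

Lemma is_Dpath_points_from m y : size y = 2 ->
  is_Dpath n m (points_from m y) =
  (nth ord0 y 1 == nth ord0 y 0 :> nat).
Proof.
case: y => [|a [|b []]] //= _; apply/existsP/eqP => [[j /eqP[-> ->]] //|eq_ba].
by exists a; rewrite /points_from /= eq_ba.
Qed.

(** A [U]-step of the full network at abscissa [i] is the step number [i - n.+1]
of the [U]-type network, which starts at abscissa [n.+1]. *)
Definition Nstep (i a b : nat) : bool :=
  if (i < n)%N then Lstep i a b
  else if i == n then b == a
  else Ustep (i - n.+1) a b.

(** The three pieces of a network path share their end points but no edge, so the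
conditions on the [n + 1 + n] steps split into those of the pieces. *)
Lemma is_Npath_points_from y : size y = (n + 1 + n).+1 ->
  is_Npath n (points_from 0 y) =
  [forall i : 'I_(n + 1 + n), Nstep i (nth ord0 y i) (nth ord0 y i.+1)].
Proof.
move=> sz_y; rewrite /is_Npath size_points_from sz_y eqxx /=.
rewrite !drop_points_from !take_points_from !add0n.
rewrite is_Lpath_points_from ?size_takel ?sz_y; [|lia..].
rewrite is_Dpath_points_from ?size_takel ?size_drop ?sz_y; [|lia..].
rewrite is_Upath_points_from ?size_drop ?sz_y; [|lia].
rewrite !nth_take // !nth_drop.
rewrite !forall_big_and !big_split_ord /= big_ord1 -andbA; congr [&& _, _ & _].
- apply: eq_bigr => i _; have lt_in := ltn_ord i.
  by rewrite /Nstep lt_in !nth_take // ltnS ltnW.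
- by rewrite /Nstep /= !addn0 ltnn eqxx addn1.
- apply: eq_bigr => i _; rewrite !nth_drop /Nstep /=.
  rewrite ltnNge (eqn_leq _ n).
  have -> : (n <= n + 1 + i)%N by lia.
  have -> /= : (n + 1 + i <= n)%N = false by lia.
  by rewrite addn1 addKn addnS.
Qed.

End PointsFrom.

(** * The weight matrices as products of step matrices *)

Section Transfer.
Variables (R : realType) (n : nat).

Definition step_mx (ok : nat -> nat -> bool) (w : point -> point -> R)
    (x : nat) : 'M[R]_n.+1 :=
  \matrix_(a, b) if ok a b then w (x, a : nat) (x.+1, b : nat) else 0.

(** A sequence of heights violating some step condition contributes a product with
a zero factor, so summing over all sequences is summing over paths only. *)
Lemma weight_mx_prod_steps (P : pred (seq point)) (w : point -> point -> R)
    (m k : nat) (ok : nat -> nat -> nat -> bool) :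
    (forall y : k.+1.-tuple 'I_n.+1, P (points_from m y) =
       [forall i : 'I_k, ok i (nth ord0 y i) (nth ord0 y i.+1)]) ->
  weight_mx n P w m k = \prod_(i < k) step_mx (ok i) w (m + i).
Proof.
move=> defP; apply/matrixP => i j.
rewrite (prod_mx_entry_sum_paths k (fun l => step_mx (ok l) w (m + l))) mxE.
rewrite big_mkcond [RHS]big_mkcond /=; apply: eq_bigr => y _.
rewrite !(tnth_nth ord0) /= {}defP.
case: ifPn => [/and3P[/forallP ok_y -> ->]|].
  rewrite /path_weight size_points_from size_tuple /=.
  apply: eq_bigr => l _; rewrite mxE ok_y.
  by rewrite !pt_points_from ?size_tuple ?addnS ?ltnS ?ltn_ord // ltnW.
case: ifP => [_|//]; rewrite andbT => /forallPn[l /negPf not_ok].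
by rewrite (bigD1 l) //= mxE not_ok mul0r.
Qed.

Variable t : 'M[R]_n.+1.

Lemma L_mxE : L_mx t = \prod_(i < n) step_mx (Lstep n i) (Lweight t 0) i.
Proof.
apply: (@weight_mx_prod_steps _ _ _ n (Lstep n)) => y.
by rewrite is_Lpath_points_from ?size_tuple.
Qed.

Lemma U_mxE : U_mx t = \prod_(i < n) step_mx (Ustep i) (Uweight t 0) i.
Proof.
apply: (@weight_mx_prod_steps _ _ _ n Ustep) => y.
by rewrite is_Upath_points_from ?size_tuple.
Qed.

Lemma D_mxE : D_mx t = diag_mx (\row_i t i i).
Proof.
have := @weight_mx_prod_steps (is_Dpath n 0) (Dweight t) 0 1
  (fun _ a b => b == a) _.
rewrite /D_mx => ->; last first.
  move=> y; rewrite is_Dpath_points_from ?size_tuple //.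
  by rewrite forall_big_and big_ord1.
apply/matrixP => i j; rewrite big_ord1 !mxE /Dweight /= inord_val.
by rewrite eq_sym -[(i == j :> nat)]/(i == j); case: eqP.
Qed.

(** Translating the [U]-type network to abscissa [n.+1] does not change its step
matrices, since the weights depend on the abscissa relative to the start. *)
Lemma network_mxE : network_mx t = L_mx t *m D_mx t *m U_mx t.
Proof.
have := @weight_mx_prod_steps (is_Npath n) (Nweight t) 0 (n + 1 + n)
  (Nstep n) _.
rewrite /network_mx => ->; last first.
  by move=> y; rewrite is_Npath_points_from ?size_tuple.
rewrite !big_split_ord big_ord1 /= L_mxE D_mxE U_mxE !mulmxE.
congr (_ * _ * _).
- apply: eq_bigr => i _; apply/matrixP => a b.
  by rewrite !mxE /Nstep /Nweight /= ltn_ord.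
- apply/matrixP => a b; rewrite !mxE /Nstep /Nweight /Dweight /= !addn0.
  rewrite ltnn eqxx inord_val eq_sym -[(a == b :> nat)]/(a == b).
  by case: eqP.
- apply: eq_bigr => i _; apply/matrixP => a b.
  rewrite !mxE /Nstep /Nweight /Uweight /= add0n.
  rewrite ltnNge (eqn_leq _ n).
  have -> : (n <= n + 1 + i)%N by lia.
  have -> /= : (n + 1 + i <= n)%N = false by lia.
  by rewrite addn1 addKn subn0.
Qed.

End Transfer.

(** * Unitriangular matrices and uniqueness of the LDU decomposition *)

Section Unitriangular.
Variable R : realType.

Lemma unit_lower1 n : unit_lower (1%:M : 'M[R]_n).
Proof.
by split=> [|i]; [exact: scalar_mx_is_trig | rewrite mxE eqxx].
Qed.

Lemma unit_lowerM n (L X : 'M[R]_n) :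
  unit_lower L -> unit_lower X -> unit_lower (L *m X).
Proof.
move=> [/is_trig_mxP trL L1] [/is_trig_mxP trX X1]; split.
  apply/is_trig_mxP => i j lt_ij; rewrite mxE big1 // => k _.
  case: (ltnP i k) => [/trL->|le_ki]; first by rewrite mul0r.
  by rewrite trX ?mulr0 // (leq_ltn_trans le_ki).
move=> i; rewrite mxE (bigD1 i) //= L1 X1 mulr1 big1 ?addr0 // => k ne_ki.
case: (ltngtP i k) => [/trL->|/trX->|/val_inj eq_ik];
  rewrite ?(mul0r, mulr0) //.
by rewrite eq_ik eqxx in ne_ki.
Qed.

Lemma unit_lower_prod n (I : finType) (F : I -> 'M[R]_n.+1) :
  (forall i, unit_lower (F i)) -> unit_lower (\prod_i F i).
Proof.
move=> lF; elim/big_ind: _ => //; first exact: unit_lower1.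
by move=> L X; apply: unit_lowerM.
Qed.

Lemma unit_lower_unit n (L : 'M[R]_n) : unit_lower L -> L \in unitmx.
Proof.
by move=> [trL L1]; rewrite unitmxE det_trig // big1 ?unitr1.
Qed.

(** Forward substitution: once the rows of [X] above row [i] are known to vanish in
column [j], the entries [(i, j)] of [L *m X] and of [X] agree.  With [X] the
inverse of [L], this shows that inverses of unit lower triangular matrices are
unit lower triangular. *)
Lemma unit_lowerM_cancel n (L X : 'M[R]_n) :
  unit_lower L -> unit_lower (L *m X) -> unit_lower X.
Proof.
move=> [/is_trig_mxP trL L1] [/is_trig_mxP trLX LX1].
have forward (i j : 'I_n) : (forall k : 'I_n, (k < i)%N -> X k j = 0) ->
    (L *m X) i j = X i j.
  move=> X0; rewrite mxE (bigD1 i) //= L1 mul1r big1 ?addr0 // => k ne_ki.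
  case: (ltngtP i k) => [/trL->|/X0->|/val_inj eq_ik];
    rewrite ?(mul0r, mulr0) //.
  by rewrite eq_ik eqxx in ne_ki.
have trX (i j : 'I_n) : (i < j)%N -> X i j = 0.
  have [m] := ubnP i; elim: m i => // m IHm i lt_im lt_ij.
  rewrite -forward ?trLX // => k lt_ki.
  by apply: IHm; [exact: leq_trans lt_ki _ | exact: ltn_trans lt_ij].
split; first exact/is_trig_mxP.
by move=> i; rewrite -forward ?LX1 // => k; apply: trX.
Qed.

Lemma unit_lower_inv n (L : 'M[R]_n) : unit_lower L -> unit_lower (invmx L).
Proof.
move=> lL; apply: (unit_lowerM_cancel lL).
by rewrite mulmxV ?unit_lower_unit //; apply: unit_lower1.
Qed.

Lemma unit_upperE n (U : 'M[R]_n) : unit_upper U <-> unit_lower U^T.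
Proof. by split=> -[trU U1]; split=> // i; have := U1 i; rewrite mxE. Qed.

Lemma unit_upper_prod n (I : finType) (F : I -> 'M[R]_n.+1) :
  (forall i, unit_upper (F i)) -> unit_upper (\prod_i F i).
Proof.
move=> uF; elim/big_ind: _ => // [|U V /unit_upperE lU /unit_upperE lV];
  apply/unit_upperE.
  by rewrite trmx1; apply: unit_lower1.
by rewrite -mulmxE trmx_mul; apply: unit_lowerM.
Qed.

(** The invertibility of [D] alone is assumed: that of [D'] comes out of the
comparison of the diagonals, before it is needed to cancel. *)
Lemma LDU_unique n (A L D U L' D' U' : 'M[R]_n) :
  (forall i, D i i != 0) ->
  is_LDU A L D U -> is_LDU A L' D' U' -> [/\ L' = L, D' = D & U' = U].
Proof.
move=> D0 [lL dD /unit_upperE uU ->] [lL' dD' /unit_upperE uU' eqA].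
have iL := unit_lower_unit lL; have iU' := unit_lower_unit uU'.
rewrite unitmx_tr in iU'.
set X := invmx L *m L'; set Y := U *m invmx U'.
have [/is_trig_mxP trX X1] : unit_lower X.
  by apply: unit_lowerM => //; apply: unit_lower_inv.
have [/is_trig_mxP trY Y1] : unit_lower Y^T.
  by rewrite trmx_mul trmx_inv; apply: unit_lowerM => //; apply: unit_lower_inv.
have eqXY : D *m Y = X *m D'.
  rewrite /X /Y mulmxA -[D *m U](mulKmx iL) [L *m _]mulmxA eqA.
  by rewrite !mulmxA mulmxK.
have [d defD] := diag_mxP _ dD; have [d' defD'] := diag_mxP _ dD'.
have entry i j : d 0 i * Y i j = X i j * d' 0 j.
  have /matrixP/(_ i j) := eqXY.
  by rewrite defD defD' mul_diag_mx mul_mx_diag !mxE.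
have d0 i : d 0 i != 0 by have := D0 i; rewrite defD mxE eqxx.
have Yii i : Y i i = 1 by have := Y1 i; rewrite mxE.
have eq_d : d' = d.
  by apply/rowP => i; have := entry i i; rewrite X1 Yii mulr1 mul1r.
have X_1 : X = 1%:M.
  apply/matrixP => i j; rewrite [RHS]mxE.
  case: (ltngtP i j) => [lt_ij|lt_ji|/val_inj ->]; last by rewrite X1 eqxx.
    by rewrite trX // -val_eqE ltn_eqF.
  have /eqP := entry i j; have := trY j i lt_ji; rewrite mxE => ->.
  rewrite mulr0 eq_sym mulf_eq0 eq_d (negPf (d0 j)) orbF => /eqP->.
  by rewrite -val_eqE gtn_eqF.
have eq_D : D' = D by rewrite defD defD' eq_d.
have Y_1 : Y = 1%:M.
  apply/matrixP => i j; apply: (mulfI (d0 i)).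
  rewrite entry X_1 !mxE eq_d; case: eqP => [->|_]; rewrite ?(mul0r,mulr0) //.
  by rewrite mulrC.
split=> //; first by rewrite -(mulKVmx iL L') -/X X_1 mulmx1.
by rewrite -(mulmxKV iU' U) -/Y Y_1 mul1mx.
Qed.

End Unitriangular.

(** * The LDU decomposition of the network matrix *)

(** An [L]-step never goes up, and a horizontal one has weight 1. *)
Lemma L_mx_unit_lower (R : realType) (n : nat) (t : 'M[R]_n.+1) :
  unit_lower (L_mx t).
Proof.
rewrite L_mxE; apply: unit_lower_prod => i; split=> [|a].
  apply/is_trig_mxP => a b lt_ab; rewrite mxE /Lstep gtn_eqF //=.
  by rewrite ltn_eqF // ltnW.
by rewrite mxE /Lstep /Lweight /= eqxx ltn_eqF.
Qed.

Lemma U_mx_unit_upper (R : realType) (n : nat) (t : 'M[R]_n.+1) :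
  unit_upper (U_mx t).
Proof.
rewrite U_mxE; apply: unit_upper_prod => i; split=> [|a].
  apply/is_trig_mxP => a b lt_ab; rewrite !mxE /Ustep ltn_eqF //=.
  by rewrite ltn_eqF // ltnW.
by rewrite mxE /Ustep /Uweight /= eqxx ltn_eqF.
Qed.

Theorem theorem2p12 (R : realType) (n : nat) (hn : (1 <= n)%N)
    (A : 'M[R]_n.+1) (hA : totally_positive A)
    (t : 'M[R]_n.+1) (ht : forall i j, 0 < t i j)
    (htA : network_mx t = A) :
  is_LDU A (L_mx t) (D_mx t) (U_mx t) /\
  (forall L D U : 'M[R]_n.+1, is_LDU A L D U ->
     [/\ L = L_mx t, D = D_mx t & U = U_mx t]).
Proof.
have LDU_A : is_LDU A (L_mx t) (D_mx t) (U_mx t).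
  split; [exact: L_mx_unit_lower | | exact: U_mx_unit_upper |].
    by rewrite D_mxE diag_mx_is_diag.
  by rewrite -htA network_mxE.
split=> // L D U; apply: LDU_unique LDU_A => i.
by rewrite D_mxE !mxE eqxx mulr1n lt0r_neq0.
Qed.
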